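(* (Type $q$-P$(A_6)$.) Let $Y(x)={}^t(y_1(x),y_2(x))$ be meromorphic on $\mathbb{C}^*$ and satisfy $Y(qx)=A(x)Y(x)$ with the matrix $A(x)$ of the context, and suppose $\lambda=a_1t$. Then $$y_1(q^2x)-\frac{(qx-a_1t)(q\kappa_1x^2-dx+\theta_1t)}{x-a_1t}y_1(qx)+\kappa_1\kappa_2x^2(qx-a_1t)y_1(x)=0,$$ $$d=q\kappa_1a_1t+\frac{\theta_1}{a_1}-q\kappa_1\kappa_2\mu .$$ Defining $y$ by $y_1(x)=(x/q-a_1t)y(x)$, one has $$y(q^2x)-(q\kappa_1x^2-dx+\theta_1t)y(qx)+\kappa_1\kappa_2x^2\left(\frac{x}{q}-a_1t\right)y(x)=0,$$ and, if $u$ is a meromorphic function on $\mathbb{C}^*$, not identically zero, with $u(qx)=(x/q-a_1t)u(x)$, then $f(x)=y(qx)/u(qx)$ satisfies $$(x-a_1t)f(qx)-(q\kappa_1x^2-dx+\theta_1t)f(x)+\kappa_1\kappa_2x^2f(x/q)=0.$$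
   Context: Let $q,t,\kappa_1,\kappa_2,a_1,\theta_1,\lambda,\mu,\omega$ be nonzero complex numbers. The matrix is $$A(x)=\begin{pmatrix}\kappa_1\{(x-\lambda)(x-\alpha)+\mu_1\}&\omega(x-\lambda)\\ \kappa_1\omega^{-1}(\gamma x+\delta)&\kappa_2(x-\lambda)+\mu_2\end{pmatrix},$$ $$\mu_1=\frac{\lambda(\lambda-a_1t)}{q\kappa_1\mu},\quad \mu_2=q\kappa_1\kappa_2\mu\lambda,\quad \alpha=\frac{\lambda^{-1}(\theta_1t-\kappa_1\mu_1-\mu_2)+\kappa_2}{\kappa_1},$$ $$\gamma=\mu_2-\kappa_2(2\lambda+\alpha-a_1t),\quad \delta=\lambda^{-1}(\alpha\lambda+\mu_1)(\kappa_2\lambda-\mu_2).$$ (This is the linear system of Murata's Lax form for the $q$-Painlevé equation of type $A_6$; it satisfies $\det A(x)=\kappa_1\kappa_2x^2(x-a_1t)$.) Equations are understood as identities of meromorphic functions. *)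

(* Defs.v *)
From HB Require Import structures.
From mathcomp Require Import all_boot all_order all_algebra.
From mathcomp Require Import complex.
From mathcomp Require Import all_classical all_reals all_analysis.

Set Implicit Arguments.
Unset Strict Implicit.
Unset Printing Implicit Defensive.

Import Order.TTheory GRing.Theory Num.Theory.
Import numFieldNormedType.Exports.

Local Open Scope classical_set_scope.
Local Open Scope ring_scope.

(* The notions below are used with C := R[i], R : realType; there,
   [derivable _ _ 1] is complex differentiability. *)
Definition holomorphic_near (C : numFieldType) (g : C -> C) (z0 : C) : Prop :=
  \forall z \near z0, derivable g z 1.

(* A meromorphic function is represented by a total function whose values at
   the points of a closed discrete set (in particular at the poles) are
   irrelevant: near z0 it is g(z) / (z - z0)^n with g holomorphic, except
   possibly at z0 itself. *)
Definition meromorphic_at (C : numFieldType) (f : C -> C) (z0 : C) : Prop :=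
  exists (n : nat) (g : C -> C),
    holomorphic_near g z0 /\
    \forall z \near z0^', f z = g z / (z - z0) ^+ n.

Definition meromorphic_Cstar (C : numFieldType) (f : C -> C) : Prop :=
  forall z0 : C, z0 != 0 -> meromorphic_at f z0.

(* Equality of meromorphic functions on C^*: the representatives agree outside
   a subset of C^* without accumulation point in C^*. *)
Definition mero_eq (C : numFieldType) (T : Type) (f g : C -> T) : Prop :=
  forall z0 : C, z0 != 0 -> \forall z \near z0^', f z = g z.

Definition mx22 (F : Type) (a b c d : F) : 'M[F]_2 :=
  \matrix_(i < 2, j < 2)
    if i == 0 then (if j == 0 then a else b) else (if j == 0 then c else d).

(* Murata's matrix A(x) for the q-Painleve equation of type A_6. *)
Definition lax_A6 (F : fieldType)
    (q t kappa1 kappa2 a1 theta1 lambda mu omega : F) (x : F) : 'M[F]_2 :=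
  let mu1 := lambda * (lambda - a1 * t) / (q * kappa1 * mu) in
  let mu2 := q * kappa1 * kappa2 * mu * lambda in
  let alpha :=
    (lambda^-1 * (theta1 * t - kappa1 * mu1 - mu2) + kappa2) / kappa1 in
  let gamma := mu2 - kappa2 * (2%:R * lambda + alpha - a1 * t) in
  let delta :=
    lambda^-1 * (alpha * lambda + mu1) * (kappa2 * lambda - mu2) in
  mx22 (kappa1 * ((x - lambda) * (x - alpha) + mu1)) (omega * (x - lambda))
       (kappa1 * omega^-1 * (gamma * x + delta)) (kappa2 * (x - lambda) + mu2).

(* Main.v *)
(** Where [x != lambda], the entry [omega * (x - lambda)] lets one eliminate the
    second component, so that [y1] satisfies
    [y1(q^2 x) - (A_11(qx) + A_12(qx) A_22(x) / A_12(x)) y1(qx)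
       + (A_12(qx) / A_12(x)) det A(x) y1(x) = 0].
    At [lambda = a1 * t] the parameter [mu1] vanishes, so [qx - a1 * t] divides
    [A_11(qx)] as well and factors out of the middle coefficient.  The two other
    equations follow by gauge transformations.  All identities are checked
    pointwise, outside a set without accumulation point in [C^*]. *)
Require Import Defs.
From HB Require Import structures.
From mathcomp Require Import all_boot all_order all_algebra.
From mathcomp Require Import complex.
From mathcomp Require Import ring.
From mathcomp Require Import all_classical all_reals all_analysis.

Set Implicit Arguments.
Unset Strict Implicit.
Unset Printing Implicit Defensive.

Import Order.TTheory GRing.Theory Num.Theory.
Import numFieldNormedType.Exports.

Local Open Scope classical_set_scope.
Local Open Scope ring_scope.

Section Algebra.
Variable F : fieldType.

Lemma lax_A6_scalar_eq (q t kappa1 kappa2 a1 theta1 mu omega x : F)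
    (Y0 Y1 Y2 : 'cV[F]_2) :
  let A := lax_A6 q t kappa1 kappa2 a1 theta1 (a1 * t) mu omega in
  let d := q * kappa1 * a1 * t + theta1 / a1 - q * kappa1 * kappa2 * mu in
  q != 0 -> t != 0 -> kappa1 != 0 -> a1 != 0 -> mu != 0 -> omega != 0 ->
  x != a1 * t ->
  Y1 = A x *m Y0 -> Y2 = A (q * x) *m Y1 ->
  Y2 0 0
  - (q * x - a1 * t) * (q * kappa1 * x ^+ 2 - d * x + theta1 * t)
      / (x - a1 * t) * Y1 0 0
  + kappa1 * kappa2 * x ^+ 2 * (q * x - a1 * t) * Y0 0 0 = 0.
Proof.
move=> A d q0 t0 k0 a0 m0 o0 xa -> ->.
have xa0 : x - a1 * t != 0 by rewrite subr_eq0.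
rewrite /A /d !mxE !big_ord_recl !big_ord0 !mxE /= !big_ord_recl !big_ord0 !mxE /=.
(* The left side is now linear in the two free entries of [Y0], and both coefficients vanish
   identically. *)
by field; rewrite ?q0 ?t0 ?k0 ?a0 ?m0 ?o0 ?xa0.
Qed.

(** The gauge factor [x / q - c] becomes [x - c] at [q * x] and [q * x - c] at [q ^+ 2 * x], so the
    hypothesis is [q * x - c] times the conclusion. *)
Lemma scalar_eq_factor (q c x p r g0 g1 g2 : F) :
  q != 0 -> x - c != 0 -> q * x - c != 0 ->
  (q ^+ 2 * x / q - c) * g2
    - (q * x - c) * p / (x - c) * ((q * x / q - c) * g1)
    + r * (q * x - c) * ((x / q - c) * g0) = 0 ->
  g2 - p * g1 + r * (x / q - c) * g0 = 0.
Proof.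
move=> q0 xc qxc E; apply: (mulfI qxc); rewrite mulr0 -{}E.
by field; rewrite q0 xc.
Qed.

(* If [u1 = 0] then also [u0 = u2 = 0], and all three quotients have the junk
   value [0]; hence zeros of the gauge factor need no separate treatment. *)
Lemma scalar_eq_gauge (q c x p r g0 g1 g2 u0 u1 u2 : F) :
  q != 0 -> x / q - c != 0 -> x - c != 0 ->
  u1 = (x / q - c) * u0 -> u2 = (q * x / q - c) * u1 ->
  g2 - p * g1 + r * (x / q - c) * g0 = 0 ->
  (x - c) * (g2 / u2) - p * (g1 / u1) + r * (g0 / u0) = 0.
Proof.
move=> q0 xqc xc -> ->; have -> : q * x / q = x by field.
have [->|u00] := eqVneq u0 0; first by rewrite !(mulr0, invr0) subrr addr0.
(* The multiplier is [u1], and [u2] is [(x - c) * u1]; clearing denominators thus gives exactly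
   [E]. *)
move=> E; apply: (mulfI (mulf_neq0 xqc u00)); rewrite mulr0 -{}E.
have xcq : x - c * q != 0.
  by apply: contra_neq xqc => H; rewrite -[c](mulfK q0) -mulrBl H mul0r.
by field; rewrite q0 u00 mulNr xcq xc.
Qed.

End Algebra.

(* [P] holds outside a subset of [C^*] without accumulation point in [C^*];
   [mero_eq f g] unfolds to [generically (fun z => f z = g z)]. *)
Definition generically (C : numFieldType) (P : C -> Prop) : Prop :=
  forall z0 : C, z0 != 0 -> \forall z \near z0^', P z.

Section Generic.
Variable C : numFieldType.
Implicit Types P : C -> Prop.

(** Multiplication by [c] preserves [C^*] and is continuous; being injective, it sends punctured
    neighbourhoods of [z0] into those of [c * z0]. This carries relations from [x] to [q * x],
    [q ^+ 2 * x] and [x / q]. *)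
Lemma generically_scale P (c : C) :
  c != 0 -> generically P -> generically (fun z => P (c * z)).
Proof.
move=> c0 gP z0 z00; have cz0 := gP _ (mulf_neq0 c0 z00).
have cz : c * z @[z --> z0] --> c * z0 by exact: mulrl_continuous.
have : nbhs z0 (fun z => c * z != c * z0 -> P (c * z)) by exact: (cz _ cz0).
apply: filterS => z Pz zz0; apply: Pz.
by apply: contra_neq zz0 => /(mulfI c0).
Qed.

Lemma generically_neq (a : C) : generically (fun z => z != a).
Proof.
move=> z0 _; have [->|az0] := eqVneq z0 a; first exact: nbhs_dnbhs_neq.
apply: nbhs_dnbhs; apply/nbhs_ballP; exists `|z0 - a| => [|z /= z0z].
  by rewrite /= normr_gt0 subr_eq0.
by apply: contraTneq z0z => ->; rewrite ltxx.
Qed.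

End Generic.

Theorem mainTheorem6 (R : realType)
    (q t kappa1 kappa2 a1 theta1 lambda mu omega : R[i])
    (hq : q != 0) (ht : t != 0) (hkappa1 : kappa1 != 0) (hkappa2 : kappa2 != 0)
    (ha1 : a1 != 0) (htheta1 : theta1 != 0) (hlambda : lambda != 0)
    (hmu : mu != 0) (homega : omega != 0)
    (Y : R[i] -> 'cV[R[i]]_2)
    (hYmero : forall i : 'I_2, meromorphic_Cstar (fun x => Y x i 0))
    (hY : mero_eq (fun x => Y (q * x))
            (fun x =>
               lax_A6 q t kappa1 kappa2 a1 theta1 lambda mu omega x *m Y x))
    (hlam : lambda = a1 * t) :
  let y1 : R[i] -> R[i] := fun x => Y x 0 0 in
  let d : R[i] :=
    q * kappa1 * a1 * t + theta1 / a1 - q * kappa1 * kappa2 * mu in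
  mero_eq
    (fun x =>
       y1 (q ^+ 2 * x)
       - (q * x - a1 * t) * (q * kappa1 * x ^+ 2 - d * x + theta1 * t)
           / (x - a1 * t) * y1 (q * x)
       + kappa1 * kappa2 * x ^+ 2 * (q * x - a1 * t) * y1 x)
    (fun=> 0)
  /\
  (forall y : R[i] -> R[i],
     mero_eq y1 (fun x => (x / q - a1 * t) * y x) ->
     mero_eq
       (fun x =>
          y (q ^+ 2 * x)
          - (q * kappa1 * x ^+ 2 - d * x + theta1 * t) * y (q * x)
          + kappa1 * kappa2 * x ^+ 2 * (x / q - a1 * t) * y x)
       (fun=> 0)
     /\
     (forall u f : R[i] -> R[i],
        meromorphic_Cstar u ->
        ~ mero_eq u (fun=> 0) ->
        mero_eq (fun x => u (q * x)) (fun x => (x / q - a1 * t) * u x) ->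
        mero_eq f (fun x => y (q * x) / u (q * x)) ->
        mero_eq
          (fun x =>
             (x - a1 * t) * f (q * x)
             - (q * kappa1 * x ^+ 2 - d * x + theta1 * t) * f x
             + kappa1 * kappa2 * x ^+ 2 * f (x / q))
          (fun=> 0))).
Proof.
move=> y1 d; rewrite {}hlam in hY.
have gqz := generically_scale hq hY.
have y1E : mero_eq
    (fun x =>
       y1 (q ^+ 2 * x)
       - (q * x - a1 * t) * (q * kappa1 * x ^+ 2 - d * x + theta1 * t)
           / (x - a1 * t) * y1 (q * x)
       + kappa1 * kappa2 * x ^+ 2 * (q * x - a1 * t) * y1 x)
    (fun=> 0).
  move=> z0 z00.
  apply: filterS3 (hY _ z00) (gqz _ z00) (generically_neq (a1 * t) z00).
  move=> x E1 E2 xa; rewrite /y1 /d.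
  apply: (lax_A6_scalar_eq hq ht hkappa1 ha1 hmu homega xa E1).
  by rewrite -E2 mulrA -expr2.
split=> // y yE.
(* The slopes needed below are [q], [1] and [q^-1]. *)
have neq_affine (a : R[i]) : a != 0 -> generically (fun z => a * z - a1 * t != 0).
  move=> a0 z0 z00.
  apply: filterS (generically_scale a0 (generically_neq (a1 * t)) z00) => x.
  by rewrite subr_eq0.
have y_eq : mero_eq
       (fun x =>
          y (q ^+ 2 * x)
          - (q * kappa1 * x ^+ 2 - d * x + theta1 * t) * y (q * x)
          + kappa1 * kappa2 * x ^+ 2 * (x / q - a1 * t) * y x)
       (fun=> 0).
  move=> z0 z00.
  have q20 : q ^+ 2 != 0 by rewrite expf_neq0.
  near=> x.
  have Ey : y1 x = (x / q - a1 * t) * y x by near: x; exact: yE.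
  have Eqy : y1 (q * x) = (q * x / q - a1 * t) * y (q * x).
    by near: x; exact: (generically_scale hq yE).
  have Eq2y : y1 (q ^+ 2 * x) = (q ^+ 2 * x / q - a1 * t) * y (q ^+ 2 * x).
    by near: x; exact: (generically_scale q20 yE).
  have xc : x - a1 * t != 0.
    by rewrite -[x]mul1r; near: x; apply: neq_affine (oner_neq0 _) _ z00.
  have qxc : q * x - a1 * t != 0 by near: x; exact: neq_affine.
  apply: (scalar_eq_factor hq xc qxc).
  by rewrite -Ey -Eqy -Eq2y; near: x; exact: y1E.
split=> // u f _ _ uE fE z0 z00.
have qV0 : q^-1 != 0 by rewrite invr_eq0.
near=> x.
have -> : f x = y (q * x) / u (q * x) by near: x; exact: fE.
have -> : f (q * x) = y (q ^+ 2 * x) / u (q ^+ 2 * x).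
  by rewrite expr2 -mulrA; near: x; exact: (generically_scale hq fE).
(* This is the relation defining [f], taken at [q^-1 * x]. *)
have -> : f (x / q) = y x / u x.
  rewrite -[in RHS](mulVKf hq x) [q^-1 * x]mulrC -/(x / q).
  by rewrite [x / q]mulrC; near: x; exact: (generically_scale qV0 fE).
apply: (@scalar_eq_gauge _ q); rewrite //.
- by rewrite [x / q]mulrC; near: x; exact: neq_affine.
- by rewrite -[x]mul1r; near: x; apply: neq_affine (oner_neq0 _) _ z00.
- by near: x; exact: uE.
- by rewrite expr2 -mulrA; near: x; exact: (generically_scale hq uE).
- by near: x; exact: y_eq.
Unshelve. all: by end_near. Qed.
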